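(* Let $R$ be a ring, let $U$ be a subgroup of $R^\times$, and let $n\geq 2$ be an integer. The map $\Psi_U$ is a one-to-one correspondence (bijection) $$\Psi_U\colon\mathrm{SL}_2(R)\backslash\{\text{paths of length }n\text{ between equivalent vertices in }\mathscr{F}_{R,U}\}\longrightarrow U\backslash\{\text{tame semiregular friezes over }R\text{ of width }n\}.$$
   Context: All rings are commutative with identity $1$; $R^\times$ is the group of units of $R$. A pair $(a,b)\in R\times R$ is unimodular if $aR+bR=R$. For a subgroup $U\leq R^\times$, the Farey complex $\mathscr{F}_{R,U}$ is the directed graph whose vertices are the orbits $U(a,b)=\{(\lambda a,\lambda b):\lambda\in U\}$ of unimodular pairs (written $a/b$), with a directed edge from $a/b$ to $c/d$ if $ad-bc\in U$. Write $\mathscr{E}_R=\mathscr{F}_{R,\{1\}}$, and let $\pi_U\colon\mathscr{E}_R\to\mathscr{F}_{R,U}$, $(x,y)\mapsto U(x,y)$. A path of length $n$ is a sequence of vertices $\langle v_0,\dots,v_n\rangle$ with $v_{i-1}\to v_i$ a directed edge for $i=1,\dots,n$. Vertices $u,v$ of $\mathscr{F}_{R,U}$ are equivalent if $v=\lambda u$ for some $\lambda\in R^\times$ (where $\lambda\, U(a,b)=U(\lambda a,\lambda b)$). A path between equivalent vertices is one with $v_0$ and $v_n$ equivalent. $\mathrm{SL}_2(R)$ acts on vertices by $\begin{pmatrix}a&b\\c&d\end{pmatrix}\colon x/y\mapsto(ax+by)/(cx+dy)$, and hence on paths. A frieze of width $n$ over $R$ is a function $\mathbf{F}\colon\{(i,j)\in\mathbb{Z}^2:0\leq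 i-j\leq n\}\to R$, $m_{i,j}=\mathbf{F}(i,j)$, with $m_{i,i}=m_{n+i,i}=0$ for all $i\in\mathbb{Z}$ and $m_{i,j}m_{i+1,j+1}-m_{i,j+1}m_{i+1,j}=1$ for $0<i-j<n$. It is tame if the 3-by-3 matrix with rows $i-1,i,i+1$ and columns $j-1,j,j+1$ of entries of $\mathbf{F}$ has determinant $0$ whenever $1<i-j<n-1$. It is semiregular if $m_{i+1,i}=1$ for all $i\in\mathbb{Z}$. The group $U$ acts on tame semiregular friezes of width $n$ by $m_{i,j}\mapsto\lambda^{(-1)^i+(-1)^j}m_{i,j}$, $\lambda\in U$. The map $\Psi_U$ is defined as follows. Given a path $\gamma$ of length $n$ between equivalent vertices in $\mathscr{F}_{R,U}$, choose any path $\langle (a_0,b_0),\dots,(a_n,b_n)\rangle$ in $\mathscr{E}_R$ that maps to $\gamma$ under $\pi_U$ (such a lift exists); then $(a_n,b_n)=\lambda(a_0,b_0)$ for some $\lambda\in R^\times$. Extend it to a bi-infinite path by $(a_{i+n},b_{i+n})=\lambda^{(-1)^i}(a_i,b_i)$ for $i\in\mathbb{Z}$. Then $\Psi_U$ sends the $\mathrm{SL}_2(R)$-orbit of $\gamma$ to the $U$-orbit of the tame semiregular frieze of width $n$ with entries $m_{i,j}=a_jb_i-b_ja_i$, $0\leq i-j\leq n$ (this is well defined). *)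

(* Defs.v *)
From mathcomp Require Import all_boot all_order all_algebra.
From mathcomp Require Import all_classical.

Set Implicit Arguments.
Unset Strict Implicit.
Unset Printing Implicit Defensive.

Import Order.TTheory GRing.Theory Num.Theory.

Local Open Scope classical_set_scope.
Local Open Scope ring_scope.

(* Rings are [comPzRingType]s, so the zero ring is allowed.  As
   [GRing.unit] and [exprz] only exist for nontrivial rings with a decidable
   notion of unit, units and their integer powers are defined here. *)

Definition units (R : comPzRingType) : set R :=
  [set x | exists y, x * y = 1].
Arguments units R : clear implicits.

(* Only meaningful on units; 0 elsewhere. *)
Definition uinv (R : comPzRingType) (x : R) : R :=
  xget 0 [set y | x * y = 1].

Definition upow (R : comPzRingType) (x : R) (k : int) : R :=
  match k with
  | Posz m => x ^+ m
  | Negz m => uinv x ^+ m.+1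
  end.

Definition unit_subgroup (R : comPzRingType) (U : set R) : Prop :=
  [/\ U `<=` units R,
      U 1,
      forall x y, U x -> U y -> U (x * y) &
      forall x, U x -> U (uinv x)].

Definition unimodular (R : comPzRingType) : set (R * R) :=
  [set p | [set r | exists x y, p.1 * x + p.2 * y = r] = [set: R]].
Arguments unimodular R : clear implicits.

Definition scale_pair (R : comPzRingType) (l : R) (p : R * R) : R * R :=
  (l * p.1, l * p.2).

Definition sl2 (R : comPzRingType) : set 'M[R]_2 := [set A | \det A = 1].
Arguments sl2 R : clear implicits.

Definition sl2_pair (R : comPzRingType) (A : 'M[R]_2) (p : R * R) : R * R :=
  (A ord0 ord0 * p.1 + A ord0 ord_max * p.2,
   A ord_max ord0 * p.1 + A ord_max ord_max * p.2).

(* The orbit U(a,b); written a/b when (a,b) is unimodular.  As a function of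
   the pair this is the projection pi_U, the vertices {(a,b)} of the Farey
   complex for U = {1} being identified with the pairs (a,b). *)
Definition pair_orbit (R : comPzRingType) (U : set R) (p : R * R) :
    set (R * R) :=
  [set scale_pair l p | l in U].

Definition farey_vertex (R : comPzRingType) (U : set R) : set (set (R * R)) :=
  [set pair_orbit U p | p in unimodular R].

Definition farey_edge (R : comPzRingType) (U : set R) (u v : set (R * R)) :
    Prop :=
  [/\ farey_vertex U u, farey_vertex U v &
      exists p q, [/\ u p, v q & U (p.1 * q.2 - p.2 * q.1)]].

Definition equivalent (R : comPzRingType) (u v : set (R * R)) : Prop :=
  exists2 l, units R l & v = scale_pair l @` u.

Definition farey_path (R : comPzRingType) (U : set R) (n : nat) :
    set ('I_n.+1 -> set (R * R)) :=
  [set g | (forall i, farey_vertex U (g i)) /\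
           forall i : 'I_n,
             farey_edge U (g (widen_ord (leqnSn n) i)) (g (lift ord0 i))].
Arguments farey_path {R} U n.

Definition equiv_path (R : comPzRingType) (U : set R) (n : nat) :
    set ('I_n.+1 -> set (R * R)) :=
  farey_path U n `&` [set g | equivalent (g ord0) (g ord_max)].
Arguments equiv_path {R} U n.

Definition path_orbit (R : comPzRingType) (n : nat)
    (g : 'I_n.+1 -> set (R * R)) : set ('I_n.+1 -> set (R * R)) :=
  [set (fun i => sl2_pair A @` g i) | A in sl2 R].

Definition path_quotient (R : comPzRingType) (U : set R) (n : nat) :
    set (set ('I_n.+1 -> set (R * R))) :=
  [set path_orbit g | g in equiv_path U n].
Arguments path_quotient {R} U n.

Definition band (n : nat) : Type :=
  {p : int * int | (0 <= p.1 - p.2) && (p.1 - p.2 <= n%:Z)}.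

(* The entry m_{i,j} of F.  The value 0 outside the band is a convention that
   never matters: for n > 0 the axioms below only mention entries inside the
   band. *)
Definition entry (R : comPzRingType) (n : nat) (F : band n -> R)
    (i j : int) : R :=
  if insub (i, j) is Some p then F p else 0.

Definition is_frieze (R : comPzRingType) (n : nat) (F : band n -> R) : Prop :=
  let m := entry F in
  (forall i, m i i = 0 /\ m (n%:Z + i) i = 0) /\
  (forall i j, 0 < i - j -> i - j < n%:Z ->
     m i j * m (i + 1) (j + 1) - m i (j + 1) * m (i + 1) j = 1).

Definition is_tame (R : comPzRingType) (n : nat) (F : band n -> R) : Prop :=
  forall i j : int, 1 < i - j -> i - j < n%:Z - 1 ->
    \det (\matrix_(k < 3, l < 3)
            entry F (i - 1 + (k : nat)%:Z) (j - 1 + (l : nat)%:Z)) = 0.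

Definition is_semiregular (R : comPzRingType) (n : nat) (F : band n -> R) :
    Prop :=
  forall i, entry F (i + 1) i = 1.

Definition tame_semiregular_frieze (R : comPzRingType) (n : nat) :
    set (band n -> R) :=
  [set F | [/\ is_frieze F, is_tame F & is_semiregular F]].
Arguments tame_semiregular_frieze R n : clear implicits.

Definition frieze_act (R : comPzRingType) (n : nat) (l : R)
    (F : band n -> R) : band n -> R :=
  fun p => upow l ((-1) ^ (val p).1 + (-1) ^ (val p).2) * F p.

Definition frieze_orbit (R : comPzRingType) (U : set R) (n : nat)
    (F : band n -> R) : set (band n -> R) :=
  [set frieze_act l F | l in U].

Definition frieze_quotient (R : comPzRingType) (U : set R) (n : nat) :
    set (set (band n -> R)) :=
  [set frieze_orbit U F | F in tame_semiregular_frieze R n].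
Arguments frieze_quotient {R} U n.

Definition path_lift (R : comPzRingType) (U : set R) (n : nat)
    (g : 'I_n.+1 -> set (R * R)) (p : 'I_n.+1 -> R * R) : Prop :=
  farey_path [set 1] n (fun i => pair_orbit [set 1] (p i)) /\
  forall i, pair_orbit U (p i) = g i.

Definition extended_lift (R : comPzRingType) (U : set R) (n : nat)
    (g : 'I_n.+1 -> set (R * R)) (P : int -> R * R) : Prop :=
  exists p l,
    [/\ path_lift U g p, units R l, p ord_max = scale_pair l (p ord0),
        (forall i : 'I_n.+1, P (i : nat)%:Z = p i) &
        (forall i : int, P (i + n%:Z) = scale_pair (upow l ((-1) ^ i)) (P i))].

Definition frieze_of (R : comPzRingType) (n : nat) (P : int -> R * R) :
    band n -> R :=
  fun q => let: (i, j) := val q in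
    (P j).1 * (P i).2 - (P j).2 * (P i).1.

(* The construction of Psi_U makes choices: a representative g of the orbit O
   and a lift of g.  Psi U O is the union, over all choices, of the resulting
   U-orbits of friezes.  It is a U-orbit (i.e. an element of frieze_quotient)
   exactly when a choice exists and all choices yield the same orbit, so
   well-definedness of Psi_U is the fact that Psi maps path_quotient to
   frieze_quotient, and then Psi U O is the U-orbit given by any choice. *)
Definition Psi (R : comPzRingType) (U : set R) (n : nat)
    (O : set ('I_n.+1 -> set (R * R))) : set (band n -> R) :=
  [set F | exists g P,
     [/\ O g, extended_lift U g P & frieze_orbit U (frieze_of (n := n) P) F]].
Arguments Psi {R} U n O.

(* Main.v *)
From Pilot Require Import Defs.
From mathcomp Require Import all_boot all_order all_algebra.
From mathcomp Require Import all_classical.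
From mathcomp Require Import ring zify.
Import Pilot.Defs.

Set Implicit Arguments.
Unset Strict Implicit.
Unset Printing Implicit Defensive.

Import Order.TTheory GRing.Theory Num.Theory.

Local Open Scope classical_set_scope.
Local Open Scope ring_scope.

(** A bi-infinite sequence of pairs P with wedge (P i) (P (i + 1)) = 1 for all i
and P (i + n) proportional to P i is the same thing as a path with a chosen
lift; its frieze has entries wedge (P j) (P i), where wedge is the 2 by 2
determinant.  The frieze rule is the Plücker relation, and tameness holds
because a matrix of wedges has rank at most 2 ([frieze_of_tame]).

The map is well defined because two lifts of one path differ by units of U
which, since consecutive wedges are 1, are alternately u and its inverse
([lifts_proportional]); this is exactly the action of U on friezes.  The action
of SL_2 leaves wedges unchanged.

It is injective because wedges determine a sequence up to SL_2: if P and Q have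
the same frieze then the matrix taking (P 0, P 1) to (Q 0, Q 1) takes P k to
Q k, since the coordinates of P k in the basis (P 0, P 1) are the wedges
of P k with these two pairs, which are entries of the frieze
([lifts_sl2_equivalent]).

It is surjective because in a tame semiregular frieze three consecutive rows
satisfy a linear recurrence m_{i+1,j} = a_i m_{i,j} - m_{i-1,j} whose coefficient
a_i = m_{i+1,i-1} is the same in all columns ([frieze_recurrence]): the frieze
rule makes the 2 by 2 minors equal to 1, so that tameness passes the recurrence
from two neighbouring columns to the next one.  Solving this recurrence for
pairs gives a sequence P with the given frieze ([frieze_chain_exists]), and the
zeros m_{n+i,i} force P (n + i) to be a multiple of P i
([chain_extended_lift]). *)

(** * Recursion and induction over the integers *)

(** Each step has a section, so the recursion also runs backwards; it builds both
the quasi-periodic extension of a lift and the sequence of a frieze. *)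
Lemma int_recursion (T : Type) (f g : int -> T -> T) (x : T) :
    (forall i, cancel (g i) (f i)) ->
  exists c : int -> T, c 0 = x /\ forall i, c (i + 1) = f i (c i).
Proof.
move=> gK.
pose up := fix up k := if k is k'.+1 then f k'%:Z (up k') else x.
pose down := fix down k := if k is k'.+1 then g (Negz k') (down k') else x.
exists (fun i => match i with Posz k => up k | Negz k => down k.+1 end).
split=> // -[k|[|k]].
- by rewrite -PoszD addn1.
- by have /= := gK (Negz 0) x.
- have ->: Negz k.+1 + 1 = Negz k by lia.
  by rewrite -[RHS]/(f _ (g _ _)) gK.
Qed.

(** With [n = 1] this is induction over the integers in both directions. *)
Lemma periodic_ind (n : nat) (Q : int -> Prop) : (0 < n)%N ->
    (forall k : nat, (k < n)%N -> Q k%:Z) ->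
    (forall i, Q i <-> Q (i + n%:Z)) ->
  forall i, Q i.
Proof.
move=> n0 Q0 QS i.
have Qr : Q (i %% n%:Z)%Z.
  have r0 : 0 <= (i %% n%:Z)%Z by apply: modz_ge0; lia.
  have rn : (i %% n%:Z)%Z < n%:Z by apply: ltz_pmod; lia.
  by have := Q0 `|(i %% n%:Z)%Z|%N; rewrite gez0_abs //; apply; lia.
rewrite (divz_eq i n%:Z) addrC.
elim/int_rect: (i %/ n%:Z)%Z => [|k IH|k IH]; first by rewrite mul0r addr0.
- have -> : k.+1%:Z * n%:Z = k%:Z * n%:Z + n%:Z by lia.
  by rewrite addrA; apply: (QS _).1.
- apply: (QS _).2; rewrite -addrA.
  by have -> : - k.+1%:Z * n%:Z + n%:Z = - k%:Z * n%:Z by lia.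
Qed.

(** * Units and alternating powers *)

Section Units.
Variable R : comPzRingType.
Implicit Types (l m : R) (i j : int) (U : set R).

Lemma mulr_uinv l : units R l -> l * uinv l = 1.
Proof. by case=> y ly; apply: (@xgetPex R 0 [set y | l * y = 1]); exists y. Qed.

Lemma units_subgroup : unit_subgroup (units R).
Proof.
split=> //.
- by exists 1; rewrite mulr1.
- by move=> l m [y ly] [z mz]; exists (y * z); ring: ly mz.
- by move=> l /mulr_uinv lV; exists l; rewrite mulrC.
Qed.

Lemma uinv_eq l m : l * m = 1 -> uinv l = m.
Proof.
move=> lm; have lV := @mulr_uinv l (ex_intro _ m lm).
by rewrite -[uinv l]mulr1 -lm mulrA [_ * l]mulrC lV mul1r.
Qed.

Definition alternate l i : R := upow l ((-1) ^ i).

Lemma sgnz_eq i : (-1 : int) ^ i = 1 \/ (-1 : int) ^ i = -1.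
Proof.
rewrite expN1r -signr_odd; case: (odd _); first by right; rewrite expr1.
by left; rewrite expr0.
Qed.

Lemma sgnzD i j : (-1 : int) ^ (i + j) = (-1) ^ i * (-1) ^ j.
Proof. exact: exprzDr. Qed.

Lemma upow1 l : upow l 1 = l. Proof. by []. Qed.
Lemma upowN1 l : upow l (-1) = uinv l. Proof. by []. Qed.

Lemma alternate0 l : alternate l 0 = l. Proof. by []. Qed.

Lemma alternate_in U l i : unit_subgroup U -> U l -> U (alternate l i).
Proof.
case=> _ _ _ UV Ul; rewrite /alternate.
by case: (sgnz_eq i) => ->; rewrite (upow1, upowN1) //; apply: UV.
Qed.

Lemma alternate_unit l i : units R l -> units R (alternate l i).
Proof. exact: alternate_in units_subgroup. Qed.

Lemma alternateS l i : units R l -> alternate l i * alternate l (i + 1) = 1.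
Proof.
move=> /mulr_uinv lV; rewrite /alternate sgnzD.
by case: (sgnz_eq i) => -> /=; rewrite ?upowN1 ?upow1 // mulrC.
Qed.

Lemma alternateD l i j : units R l ->
  alternate l (j + i) = alternate (alternate l j) i.
Proof.
move=> /mulr_uinv lV; rewrite /alternate sgnzD.
case: (sgnz_eq i) => ->; case: (sgnz_eq j) => ->;
  rewrite ?(upowN1, mulN1r, mulr1, mul1r, opprK, upow1) //.
by rewrite (@uinv_eq (uinv l) l) // mulrC.
Qed.

Lemma alternateM l m i : units R l -> units R m ->
  alternate (l * m) i = alternate l i * alternate m i.
Proof.
move=> /mulr_uinv lV /mulr_uinv mV; rewrite /alternate.
case: (sgnz_eq i) => ->; rewrite ?(upow1, upowN1) //.
by apply: uinv_eq; ring: lV mV.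
Qed.

Lemma upow_sgnD l i j : units R l ->
  upow l ((-1) ^ i + (-1) ^ j) = alternate l i * alternate l j.
Proof.
move=> /mulr_uinv lV; rewrite /alternate.
case: (sgnz_eq i) => ->; case: (sgnz_eq j) => -> //=.
by rewrite ?(upow1, upowN1) mulrC.
Qed.

End Units.

(** * Pairs, wedges and the action of SL_2 *)

Section Pairs.
Variable R : comPzRingType.
Implicit Types (p q x : R * R) (l m : R) (A B : 'M[R]_2) (U : set R).

Definition wedge p q : R := p.1 * q.2 - p.2 * q.1.

Lemma scale_pairA l m p : scale_pair l (scale_pair m p) = scale_pair (l * m) p.
Proof. by rewrite /scale_pair /= !mulrA. Qed.

Lemma scale_pair1 p : scale_pair 1 p = p.
Proof. by case: p => a b; rewrite /scale_pair !mul1r. Qed.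

Lemma wedgeC p q : wedge p q = - wedge q p.
Proof. by rewrite /wedge; ring. Qed.

Lemma wedge_scalel l p q : wedge (scale_pair l p) q = l * wedge p q.
Proof. by rewrite /wedge /=; ring. Qed.

Lemma wedge_scaler l p q : wedge p (scale_pair l q) = l * wedge p q.
Proof. by rewrite /wedge /=; ring. Qed.

(** Cramer's rule: a pair of wedge 1 is a basis, and the coordinates are wedges. *)
Lemma wedge_basis p q x : wedge p q = 1 ->
  x = (wedge x q * p.1 + wedge p x * q.1, wedge x q * p.2 + wedge p x * q.2).
Proof.
case: p q x => [a b] [c d] [x y]; rewrite /wedge /= => /eqP.
by rewrite subr_eq => /eqP pq; congr (_, _); ring: pq.
Qed.

Lemma unimodularP p : unimodular R p <-> exists q, wedge p q = 1.
Proof.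
split=> [pu|[q pq]].
  have : [set: R] 1 by [].
  rewrite -pu => -[x [y xy]].
  by exists (- y, x); rewrite /wedge /= -xy; ring.
apply/seteqP; split=> // r _.
exists (q.2 * r), (- q.1 * r).
transitivity (wedge p q * r); last by rewrite pq mul1r.
by rewrite /wedge; ring.
Qed.

Lemma sl2_pair_mul A B p : sl2_pair (A *m B) p = sl2_pair A (sl2_pair B p).
Proof.
rewrite /sl2_pair !mxE !big_ord_recl !big_ord0 /=.
have -> : lift ord0 ord0 = ord_max :> 'I_2 by apply/val_inj.
by congr (_, _); ring.
Qed.

Lemma sl2_pair1 p : sl2_pair 1%:M p = p.
Proof. by case: p => a b; rewrite /sl2_pair !mxE /=; congr (_, _); ring. Qed.

Lemma sl2_pair_scale A l p :
  sl2_pair A (scale_pair l p) = scale_pair l (sl2_pair A p).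
Proof. by congr (_, _) => /=; ring. Qed.

Lemma det_mx22 A :
  \det A = A ord0 ord0 * A ord_max ord_max - A ord0 ord_max * A ord_max ord0.
Proof.
rewrite (expand_det_row A ord0) !big_ord_recl big_ord0 /cofactor !det_mx11 !mxE.
have -> : lift ord0 ord0 = ord_max :> 'I_2 by apply/val_inj.
have -> : lift ord_max 0 = ord0 :> 'I_2 by apply/val_inj.
by rewrite /= addn0 expr0 expr1; ring.
Qed.

Lemma wedge_sl2 A p q : sl2 R A ->
  wedge (sl2_pair A p) (sl2_pair A q) = wedge p q.
Proof.
rewrite /sl2 /= det_mx22 /wedge /= => dA.
by rewrite -[RHS]mul1r -dA; ring.
Qed.

(** The matrix taking the basis (p, q) to (p', q') has determinant 1; it takes x
to the y that has the same coordinates, that is, the same wedges. *)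
Lemma sl2_transport p q p' q' : wedge p q = 1 -> wedge p' q' = 1 ->
  exists2 A, sl2 R A & forall x y, wedge x q = wedge y q' ->
    wedge p x = wedge p' y -> sl2_pair A x = y.
Proof.
move=> pq pq'.
pose A : 'M[R]_2 := \matrix_(i, j)
  if i == ord0 then
    if j == ord0 then q.2 * p'.1 - p.2 * q'.1 else p.1 * q'.1 - q.1 * p'.1
  else
    if j == ord0 then q.2 * p'.2 - p.2 * q'.2 else p.1 * q'.2 - q.1 * p'.2.
exists A; last first.
  move=> x y xq px; rewrite [y in RHS](wedge_basis y pq') -xq -px.
  by rewrite /sl2_pair !mxE /wedge /=; congr (_, _); ring.
rewrite /sl2 /= det_mx22 !mxE /=.
transitivity (wedge p q * wedge p' q'); last by rewrite pq pq' mulr1.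
by rewrite /wedge; ring.
Qed.

Lemma sl2_inverse A : sl2 R A ->
  exists2 B, sl2 R B & forall x, sl2_pair B (sl2_pair A x) = x.
Proof.
move=> hA.
have e12 : wedge (1, 0) (0, 1) = 1 by rewrite /wedge /=; ring.
have [B hB BE] := sl2_transport (etrans (wedge_sl2 _ _ hA) e12) e12.
by exists B => // x; apply: BE; apply: wedge_sl2.
Qed.

Lemma sl2_pair_orbit A U p :
  sl2_pair A @` pair_orbit U p = pair_orbit U (sl2_pair A p).
Proof.
apply/seteqP; split=> x.
  by case=> _ [l Ul <-] <-; exists l => //; rewrite sl2_pair_scale.
by case=> l Ul <-; exists (scale_pair l p); [exists l | rewrite sl2_pair_scale].
Qed.

Lemma pair_orbit_refl U p : unit_subgroup U -> pair_orbit U p p.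
Proof. by case=> _ U1 _ _; exists 1; rewrite ?scale_pair1. Qed.

Lemma pair_orbit_scale U l p : unit_subgroup U -> U l ->
  pair_orbit U (scale_pair l p) = pair_orbit U p.
Proof.
case=> Uu U1 UM UV Ul; apply/seteqP; split=> x [m Um <-].
  by exists (m * l); [apply: UM | rewrite scale_pairA].
exists (m * uinv l); first by apply: UM => //; apply: UV.
by rewrite scale_pairA -mulrA [_ * l]mulrC mulr_uinv ?mulr1 //; apply: Uu.
Qed.

Lemma path_orbit_sl2 n A (g : 'I_n.+1 -> set (R * R)) : sl2 R A ->
  path_orbit (fun i => sl2_pair A @` g i) = path_orbit g.
Proof.
have sub B (h : 'I_n.+1 -> set (R * R)) : sl2 R B ->
    path_orbit (fun i => sl2_pair B @` h i) `<=` path_orbit h.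
  move=> hB _ [C hC <-]; exists (C *m B).
    by rewrite /sl2 /= det_mulmx hC hB mulr1.
  apply/funext => i; rewrite image_comp.
  by congr (_ @` _); apply/funext => x; rewrite /= sl2_pair_mul.
move=> hA; apply/seteqP; split; first exact: sub.
have [B hB BK] := sl2_inverse hA.
have {1}-> : g = fun i => sl2_pair B @` (sl2_pair A @` g i).
  apply/funext => i; rewrite image_comp.
  by rewrite -[LHS]image_id; congr (_ @` _); apply/funext => x; rewrite /= BK.
exact: sub.
Qed.

End Pairs.

(** * Lifts of paths *)

Section Lifts.
Variables (R : comPzRingType) (U : set R) (n : nat).
Hypotheses (hU : unit_subgroup U) (n0 : (0 < n)%N).
Implicit Types (P Q : int -> R * R) (g : 'I_n.+1 -> set (R * R)).

Definition unit_chain P := forall i, wedge (P i) (P (i + 1)) = 1.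

Lemma pair_orbit_set1 (p : R * R) : pair_orbit [set 1] p = [set p].
Proof. by rewrite /pair_orbit image_set1 scale_pair1. Qed.

Lemma path_liftP g (p : 'I_n.+1 -> R * R) : path_lift U g p <->
  (forall i : 'I_n, wedge (p (widen_ord (leqnSn n) i)) (p (lift ord0 i)) = 1) /\
  forall i, pair_orbit U (p i) = g i.
Proof.
rewrite /path_lift /farey_path /=; split=> -[] H pg; split=> //.
  move=> i; have [_ _ [a [b []]]] := H.2 i.
  by rewrite !pair_orbit_set1 => -> ->.
have uni i : farey_vertex [set 1] (pair_orbit [set 1] (p i)).
  exists (p i) => //; apply/unimodularP.
  case: (ltnP i n) => [lt_in|le_ni].
    exists (p (lift ord0 (Ordinal lt_in))); rewrite -(H (Ordinal lt_in)).
    congr (wedge (p _) _).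
    exact/val_inj.
  have n1 : (n.-1 < n)%N by rewrite prednK.
  exists (scale_pair (-1) (p (widen_ord (leqnSn n) (Ordinal n1)))).
  transitivity (wedge (p (widen_ord (leqnSn n) (Ordinal n1))) (p i)).
    by rewrite /wedge /=; ring.
  rewrite -(H (Ordinal n1)); congr (wedge _ (p _)); apply/val_inj => /=.
  by rewrite /bump /= add1n prednK //; apply/eqP; rewrite eqn_leq -ltnS ltn_ord.
split=> // i; split; [exact: uni | exact: uni |].
by do 2 eexists; rewrite !pair_orbit_set1; split; [reflexivity..|apply: H].
Qed.

(** An extended lift is a quasi-periodic sequence all of whose consecutive wedges
are 1: the multipliers of P i and P (i + 1) are inverse to each other, so the
condition passes from one period to the next. *)
Lemma extended_liftP g P : extended_lift U g P <-> exists l,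
  [/\ units R l, unit_chain P,
      (forall i, P (i + n%:Z) = scale_pair (alternate l i) (P i)) &
      forall i : 'I_n.+1, pair_orbit U (P (i : nat)%:Z) = g i].
Proof.
split=> [[p [l [/path_liftP[pw pg] lu pl Pp Pn]]]|[l [lu Pw Pn Pg]]]; last first.
  exists (fun i => P (i : nat)%:Z), l; split=> //.
    apply/path_liftP; split=> // i.
    by rewrite -(Pw i) /= /bump /= add1n -addn1 PoszD.
  by rewrite /= -[n%:Z]add0r Pn.
exists l; split=> // [|i]; last by rewrite Pp.
apply: (periodic_ind n0) => [k kn|i].
  rewrite -(pw (Ordinal kn)) -!Pp /= /bump /= add1n.
  by rewrite -addn1 PoszD.
rewrite addrAC !Pn wedge_scalel wedge_scaler mulrA.
by rewrite -/(alternate l i) -/(alternate l (i + 1)) alternateS // mul1r.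
Qed.

Lemma lift_exists g : equiv_path U n g -> exists P, extended_lift U g P.
Proof.
case=> -[gv ge] [l0 l0u gl0].
have [Uu U1 UM UV] := hU.
have build k : (k <= n)%N -> exists p : nat -> R * R,
    (forall i, (i < k)%N -> wedge (p i) (p i.+1) = 1) /\
    forall i, (i <= k)%N -> pair_orbit U (p i) = g (inord i).
  elim: k => [_|k IH kn].
    case: (gv ord0) => p0 _ gp0; exists (fun=> p0); split=> // i.
    rewrite leqn0 => /eqP ->.
    by rewrite gp0; congr (g _); apply/val_inj; rewrite /= inordK.
  have [p [pw pg]] := IH (ltnW kn).
  have := ge (Ordinal kn).
  have -> : widen_ord (leqnSn n) (Ordinal kn) = inord k.
    by apply/val_inj; rewrite /= inordK // ltnS ltnW.
  have -> : lift ord0 (Ordinal kn) = inord k.+1.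
    by apply/val_inj; rewrite /= inordK.
  case=> _ [q0 _ gq0] [x [y [gx gy Uxy]]].
  move: gx gy; rewrite -pg // -gq0 => -[a Ua xE] [b Ub yE].
  have yq : pair_orbit U y = pair_orbit U q0 by rewrite -yE pair_orbit_scale.
  (* rescaling y makes the edge out of the chosen representative p k have
     determinant exactly 1 *)
  pose c := uinv (x.1 * y.2 - x.2 * y.1).
  exists (fun i => if i == k.+1 then scale_pair (a * c) y else p i).
  split=> i.
    rewrite ltnS leq_eqVlt => /orP[/eqP ->|ik].
      rewrite eqxx ltn_eqF // wedge_scaler.
      rewrite -[RHS](mulr_uinv (Uu _ Uxy)) -/c -xE /wedge /=; ring.
    by rewrite !ltn_eqF ?pw //; lia.
  rewrite leq_eqVlt => /orP[/eqP ->|ik].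
    by rewrite eqxx pair_orbit_scale ?yq //; apply: UM => //; apply: UV.
  by rewrite ltn_eqF ?pg.
have {build} [p [pw pg]] := build n (leqnn n).
have [l lu pn] : exists2 l, units R l & p n = scale_pair l (p 0%N).
  have : g ord_max (p n).
    have -> : ord_max = inord n :> 'I_n.+1 by apply/val_inj; rewrite /= inordK.
    by rewrite -pg //; apply: pair_orbit_refl.
  have -> : g ord_max = scale_pair l0 @` pair_orbit U (p 0%N).
    rewrite gl0 pg //; congr (_ @` g _); apply: ord_inj.
    by rewrite /= inordK.
  case=> _ [u Uu' <-] <-; exists (l0 * u); last by rewrite scale_pairA.
  by have [_ _ uM _] := units_subgroup R; apply: uM => //; apply: Uu.
(* the recursion is on the number q of periods, its state being the pairs of one
   whole period: position r of period q is the integer r + q * n *)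
pose f (e : int -> R) (q : int) (b : nat -> R * R) (r : nat) :=
  scale_pair (e (r%:Z + q * n%:Z)) (b r).
have fK q : cancel (f (fun i => uinv (alternate l i)) q) (f (alternate l) q).
  move=> b; apply/funext => r; rewrite /f scale_pairA mulr_uinv ?scale_pair1 //.
  exact: alternate_unit.
have [c [c0 cS]] := int_recursion p fK.
have nz : n%:Z != 0 by lia.
pose P (i : int) := c (i %/ n%:Z)%Z `|(i %% n%:Z)%Z|%N.
have Pn i : P (i + n%:Z) = scale_pair (alternate l i) (P i).
  rewrite /P divzDr ?dvdzz // divzz nz modzDr cS /f gez0_abs ?modz_ge0 //.
  by rewrite addrC -divz_eq.
have P0 k : (k <= n)%N -> P k%:Z = p k.
  rewrite leq_eqVlt => /orP[/eqP ->|kn]; last first.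
    by rewrite /P divz_small ?modz_small ?c0 //; lia.
  rewrite -[n%:Z]add0r Pn /P div0z mod0z c0 pn; congr scale_pair.
exists P, (fun i => p (val i)), l; split=> //; last first.
  by move=> i; rewrite P0 //; apply: (ltn_ord i).
apply/path_liftP; split=> i; first exact: (pw i (ltn_ord i)).
by rewrite pg ?inord_val //; apply: (ltn_ord i).
Qed.

Lemma extended_lift_sl2 A g P : sl2 R A -> extended_lift U g P ->
  extended_lift U (fun i => sl2_pair A @` g i) (fun i => sl2_pair A (P i)).
Proof.
move=> hA /extended_liftP[l [lu Pw Pn Pg]]; apply/extended_liftP.
exists l; split=> // i; first by rewrite wedge_sl2.
  by rewrite Pn sl2_pair_scale.
by rewrite -Pg sl2_pair_orbit.
Qed.

(** A lift can only be changed by multiplying the pair at position k by some u_k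
in U.  As consecutive wedges stay 1, u_k * u_(k+1) = 1.  Comparing both lifts at
n determines how the multiplier of the period changes, and this carries the
relation to all integers. *)
Lemma lifts_proportional g P Q : extended_lift U g P -> extended_lift U g Q ->
  exists2 u, U u & forall i, Q i = scale_pair (alternate u i) (P i).
Proof.
move=> /extended_liftP[l [lu Pw Pn Pg]] /extended_liftP[m [mu Qw Qn Qg]].
have [Uu U1 UM UV] := hU.
have coef (i : 'I_n.+1) :
    exists2 u, U u & Q (i : nat)%:Z = scale_pair u (P (i : nat)%:Z).
  have : g i (Q (i : nat)%:Z) by rewrite -Qg; apply: pair_orbit_refl.
  by rewrite -Pg => -[u ? <-]; exists u.
have [u uU Q0] := coef ord0; exists u => //.
have uu := Uu _ uU.
have Qk (k : nat) : (k <= n)%N ->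
    Q k%:Z = scale_pair (alternate u k%:Z) (P k%:Z).
  elim: k => [_|k IH kn]; first by rewrite Q0.
  have [v Uv] := coef (Ordinal (kn : (k.+1 < n.+1)%N)); rewrite /= => Qv.
  have := Qw k%:Z; rewrite -[k%:Z + 1]PoszD addn1 Qv IH 1?ltnW //.
  rewrite wedge_scalel wedge_scaler mulrA.
  rewrite -[in P k.+1]addn1 PoszD Pw mulr1 => v1.
  have aS := alternateS k%:Z uu.
  congr scale_pair; rewrite -addn1 PoszD.
  rewrite -[LHS]mul1r -aS; ring: v1.
(* both sides are the factor taking P 0 to Q n *)
have mE : m * u = alternate u n%:Z * l.
  have : Q n%:Z = scale_pair (m * u) (P 0).
    by rewrite -[n%:Z]add0r Qn alternate0 Q0 scale_pairA.
  rewrite Qk // -[in P n%:Z](add0r n%:Z) Pn alternate0 scale_pairA => E.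
  have := congr1 (fun x => wedge x (P 1)) E; rewrite !wedge_scalel.
  by have := Pw 0; rewrite add0r => ->; rewrite !mulr1.
apply: (periodic_ind n0) => [k kn|i]; first by rewrite Qk // ltnW.
have au := alternate_unit.
have E : alternate m i * alternate u i = alternate u (i + n%:Z) * alternate l i.
  rewrite -alternateM // mE alternateM //; last exact: au.
  by rewrite -alternateD // addrC.
rewrite Qn Pn; split=> [->|].
  by rewrite !scale_pairA E.
rewrite scale_pairA -E => /(congr1 (scale_pair (uinv (alternate m i)))).
rewrite !scale_pairA mulrA [uinv _ * _]mulrC mulr_uinv ?mul1r ?scale_pair1 //.
exact: au.
Qed.

End Lifts.

(** * Friezes and their action of U *)

Section Friezes.
Variables (R : comPzRingType) (n : nat).
Implicit Types (P Q : int -> R * R) (F G : band n -> R) (i j : int).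

Lemma entryP F G : (forall i j, entry F i j = entry G i j) -> F = G.
Proof.
move=> FG; apply/funext => p; have := FG (val p).1 (val p).2.
by rewrite /entry -surjective_pairing valK.
Qed.

Lemma entry_frieze_of P i j : 0 <= i - j -> i - j <= n%:Z ->
  entry (frieze_of (n := n) P) i j = wedge (P j) (P i).
Proof.
move=> ij0 ijn; rewrite /entry; case: insubP => [p _ pE|]; last first.
  by rewrite /= ij0 ijn.
by rewrite /frieze_of pE.
Qed.

Lemma entry_out F i j : ~~ ((0 <= i - j) && (i - j <= n%:Z)) -> entry F i j = 0.
Proof. by move=> out; rewrite /entry insubN. Qed.

Lemma entry_act l F i j : units R l ->
  entry (frieze_act l F) i j = alternate l i * alternate l j * entry F i j.
Proof.
move=> lu; rewrite /entry; case: insubP => [p _ pE|_]; last by rewrite mulr0.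
by rewrite /frieze_act pE /= upow_sgnD.
Qed.

Lemma frieze_of_alternate u P Q : units R u ->
    (forall i, Q i = scale_pair (alternate u i) (P i)) ->
  frieze_of Q = frieze_act u (frieze_of P) :> (band n -> R).
Proof.
move=> uu QP; apply: entryP => i j; rewrite entry_act //.
have [/andP[ij0 ijn]|out] := boolP ((0 <= i - j) && (i - j <= n%:Z)).
  by rewrite !entry_frieze_of // !QP wedge_scalel wedge_scaler; ring.
by rewrite !entry_out ?mulr0.
Qed.

Lemma frieze_orbit_act (U : set R) u F : unit_subgroup U -> U u ->
  frieze_orbit U (frieze_act u F) = frieze_orbit U F.
Proof.
move=> [Uu U1 UM UV] Ul.
have actM l m G : U l -> U m ->
    frieze_act l (frieze_act m G) = frieze_act (l * m) G.
  move=> /Uu lu /Uu mu; apply: entryP => i j.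
  have lmu : units R (l * m).
    by have [_ _ uM _] := units_subgroup R; apply: uM.
  by rewrite !entry_act // !alternateM //; ring.
apply/seteqP; split=> _ [l Ull <-].
  by exists (l * u); rewrite ?actM //; apply: UM.
have UVu := UV _ Ul.
exists (l * uinv u); first exact: UM.
rewrite actM //; last exact: UM.
by rewrite -mulrA [_ * u]mulrC mulr_uinv ?mulr1 //; apply: Uu.
Qed.

Lemma frieze_orbit_refl (U : set R) F : unit_subgroup U -> frieze_orbit U F F.
Proof.
move=> hU; have [Uu U1 _ _] := hU; exists 1 => //; apply: entryP => i j.
have a1 k : alternate (1 : R) k = 1.
  rewrite /alternate; case: (sgnz_eq k) => -> //.
  by rewrite upowN1 (uinv_eq (mulr1 1)).
by rewrite entry_act ?a1 ?mul1r //; apply: Uu.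
Qed.

(** * The frieze of a lift *)

Lemma wedge_plucker (p q r s : R * R) :
  wedge p r * wedge q s - wedge q r * wedge p s = wedge p q * wedge r s.
Proof. by rewrite /wedge; ring. Qed.

Lemma det_mx33 (f : nat -> nat -> R) :
  \det (\matrix_(k < 3, l < 3) f k l) =
    f 0%N 0%N * (f 1%N 1%N * f 2%N 2%N - f 1%N 2%N * f 2%N 1%N)
  - f 0%N 1%N * (f 1%N 0%N * f 2%N 2%N - f 1%N 2%N * f 2%N 0%N)
  + f 0%N 2%N * (f 1%N 0%N * f 2%N 1%N - f 1%N 1%N * f 2%N 0%N).
Proof.
rewrite (expand_det_row _ ord0) !big_ord_recl big_ord0 /cofactor !det_mx22 !mxE.
by rewrite /= /bump /=; ring.
Qed.

Lemma frieze_of_tame (U : set R) (g : 'I_n.+1 -> set (R * R)) P :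
    (0 < n)%N -> extended_lift U g P ->
  tame_semiregular_frieze R n (frieze_of P).
Proof.
move=> n0 /(extended_liftP _ n0)[l [lu Pw Pn _]].
split.
- split=> [i|i j ij0 ijn]; last first.
    rewrite !entry_frieze_of; [|lia..].
    by rewrite wedge_plucker !Pw mulr1.
  rewrite !entry_frieze_of; [|lia..].
  rewrite [n%:Z + i]addrC Pn wedge_scaler.
  by split; rewrite /wedge; ring.
- move=> i j ij1 ijn.
  rewrite (det_mx33 (fun k l => entry _ (i - 1 + k%:Z) (j - 1 + l%:Z))).
  rewrite !entry_frieze_of; [|lia..].
  by rewrite /wedge; ring.
- move=> i; rewrite entry_frieze_of; [|lia..].
  exact: Pw.
Qed.

(** * The sequence of a frieze *)

Section Recurrence.
Variable F : band n -> R.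
Hypothesis hF : tame_semiregular_frieze R n F.
Let m := entry F.

Definition quiddity i := m (i + 1) (i - 1).

(** Induction on the distance from the diagonal.  At distance 1 this is the
definition of the quiddity and at distance 2 it is the frieze rule; further out,
tameness gives each column from the two columns to its right. *)
Lemma frieze_recurrence i j : 1 <= i - j -> i - j < n%:Z ->
  m (i + 1) j = quiddity i * m i j - m (i - 1) j.
Proof.
case: hF => -[mz mr] mt ms.
have m0 k : m k k = 0 by case: (mz k).
pose rule i k := m (i + 1) k = quiddity i * m i k - m (i - 1) k.
suff rec (d : nat) :
    (forall i, (d.+1 < n)%N -> rule i (i - d.+1%:Z)) /\
    (forall i, (d.+2 < n)%N -> rule i (i - d.+2%:Z)).
  move=> ij1 ijn; have := (rec `|(i - j - 1)%R|%N).1 i.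
  have -> : i - `|(i - j - 1)%R|%N.+1%:Z = j by lia.
  by rewrite /rule; apply; lia.
rewrite /rule; elim: d {i j} => [|d [IH1 IH2]]; split=> // i dn.
- have := ms (i - 1); rewrite subrK => mi; rewrite -/m in mi.
  by rewrite mi m0 mulr1 subr0.
- have := mr i (i - 2%:Z); rewrite -/m.
  have -> : i - 2%:Z + 1 = i - 1 by lia.
  have := ms (i - 1); rewrite subrK => mi; rewrite -/m in mi.
  have := ms (i - 2%:Z); have -> : i - 2%:Z + 1 = i - 1 by lia.
  rewrite -/m mi => -> /(_ _ _) <-; [|lia..].
  by rewrite /quiddity; ring.
(* The recurrence holds in the two right-hand columns of the 3 by 3 matrix below,
   so subtracting it from the last row leaves a single entry, whose cofactor is a
   2 by 2 minor equal to 1. *)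
set j := i - d.+3%:Z.
have jE2 : i - d.+2%:Z = j + 1 by rewrite /j; lia.
have jE1 : i - d.+1%:Z = j + 1 + 1 by rewrite /j; lia.
have := IH1 i; have := IH2 i; rewrite jE1 jE2 => /(_ _) r2 /(_ _) r1.
have {}r1 := r1 ltac:(lia); have {}r2 := r2 ltac:(lia).
have t : \det (\matrix_(k < 3, l < 3)
    m (i - 1 + (k : nat)%:Z) (j + 1 - 1 + (l : nat)%:Z)) = 0.
  by apply: mt; rewrite /j; lia.
have minor : m (i - 1) (j + 1) * m i (j + 1 + 1)
    - m (i - 1) (j + 1 + 1) * m i (j + 1) = 1.
  by have := mr (i - 1) (j + 1); rewrite subrK; apply; rewrite /j; lia.
move: t; rewrite (det_mx33 (fun k l => m (i - 1 + k%:Z) (j + 1 - 1 + l%:Z))).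
have -> : j + 1 - 1 = j by lia.
have -> : i - 1 + 0%:Z = i - 1 by lia.
have -> : i - 1 + 1%:Z = i by lia.
have -> : i - 1 + 2%:Z = i + 1 by lia.
have -> : j + 0%:Z = j by lia.
have -> : j + 2%:Z = j + 1 + 1 by lia.
rewrite r1 r2 => t.
apply/eqP; rewrite -subr_eq0 -[X in X == 0]mulr1 -minor -t; apply/eqP; ring.
Qed.

(** Any solution of the recurrence whose first two pairs have wedge 1 will do;
each column of the frieze satisfies the same recurrence with the same two
initial values as wedge (P j) (P i) does in i. *)
Lemma frieze_chain_exists : (1 < n)%N ->
  exists P, unit_chain P /\ frieze_of P = F.
Proof.
move=> n1.
pose f i (s : (R * R) * (R * R)) :=
  (s.2, (quiddity (i + 1) * s.2.1 - s.1.1, quiddity (i + 1) * s.2.2 - s.1.2)).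
pose f' i (s : (R * R) * (R * R)) :=
  ((quiddity (i + 1) * s.1.1 - s.2.1, quiddity (i + 1) * s.1.2 - s.2.2), s.1).
have f'K i : cancel (f' i) (f i).
  move=> [[a b] [c d]]; rewrite /f /f' /=.
  by congr (_, (_, _)); ring.
have [c [c0 cS]] := int_recursion ((1, 0), (0, 1)) f'K.
pose P i := (c i).1.
have c2 i : (c i).2 = P (i + 1) by rewrite /P cS.
have PS i : P (i + 1 + 1) = (quiddity (i + 1) * (P (i + 1)).1 - (P i).1,
                             quiddity (i + 1) * (P (i + 1)).2 - (P i).2).
  by rewrite {1}/P cS /= -c2 cS /= c2.
have Pw : unit_chain P.
  have step i : wedge (P (i + 1)) (P (i + 1 + 1)) = wedge (P i) (P (i + 1)).
    by rewrite PS /wedge /=; ring.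
  apply: (@periodic_ind 1) => // [[|//] _|i].
    by rewrite -c2 /P c0 /wedge /=; ring.
  by rewrite step.
exists P; split=> //.
case: (hF) => -[mz _] _ ms.
have mP (d : nat) j :
    ((d <= n)%N -> m (j + d%:Z) j = wedge (P j) (P (j + d%:Z))) /\
    ((d < n)%N -> m (j + d%:Z + 1) j = wedge (P j) (P (j + d%:Z + 1))).
  elim: d => [|d [IH1 IH2]].
    rewrite addr0 Pw /m (mz j).1 ms; split=> // _.
    by rewrite /wedge; ring.
  have dE : j + d.+1%:Z = j + d%:Z + 1 by lia.
  rewrite dE; split=> dn; first exact: IH2.
  rewrite frieze_recurrence; [|lia..].
  rewrite addrK IH1 ?IH2 ?PS; [|lia..].
  by rewrite /wedge /=; ring.
apply: entryP => i j.
have [/andP[ij0 ijn]|out] := boolP ((0 <= i - j) && (i - j <= n%:Z)).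
  rewrite entry_frieze_of //; have := (mP `|(i - j)%R|%N j).1.
  have -> : j + `|(i - j)%R|%N%:Z = i by lia.
  by move=> <- //; lia.
by rewrite !entry_out.
Qed.

End Recurrence.

(** The zeros of the frieze give P (i + n) = l_i * P i, and l_i * l_(i+1) = 1
because wedges one period apart are both 1. *)
Lemma chain_extended_lift (U : set R) P : (0 < n)%N -> unit_chain P ->
    (forall i, wedge (P i) (P (i + n%:Z)) = 0) ->
  extended_lift U (fun k : 'I_n.+1 => pair_orbit U (P (k : nat)%:Z)) P.
Proof.
move=> n0 Pw Pz; apply/extended_liftP => //.
pose l i := wedge (P (i + n%:Z)) (P (i + 1)).
have Pl i : P (i + n%:Z) = scale_pair (l i) (P i).
  rewrite [LHS](wedge_basis (P (i + n%:Z)) (Pw i)) Pz.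
  by rewrite /scale_pair -/(l i); congr (_, _); ring.
have lS i : l i * l (i + 1) = 1.
  have := Pw (i + n%:Z); rewrite addrAC !Pl wedge_scalel wedge_scaler Pw.
  by rewrite mulr1.
have lu i : units R (l i) by exists (l (i + 1)).
exists (l 0); split=> // i; rewrite Pl; congr scale_pair.
apply: (@periodic_ind 1 (fun i => l i = alternate (l 0) i)) => // {i}.
  by case.
move=> i; have aS := alternateS i (lu 0); have lSi := lS i.
by split=> E; rewrite -[LHS]mulr1 -aS -E; ring: lSi.
Qed.

Lemma extended_lift_path (U : set R) (g : 'I_n.+1 -> set (R * R)) P :
  unit_subgroup U -> (0 < n)%N -> extended_lift U g P -> equiv_path U n g.
Proof.
move=> hU n0 /(extended_liftP _ n0)[l [lu Pw Pn Pg]].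
have [Uu U1 UM UV] := hU.
have gv (i : 'I_n.+1) : farey_vertex U (g i).
  rewrite -Pg; exists (P (i : nat)%:Z) => //; apply/unimodularP.
  by exists (P ((i : nat)%:Z + 1)).
split=> /=.
  split=> // i; split=> //.
  exists (P (i : nat)%:Z), (P ((i : nat)%:Z + 1)).
  split; last by have := Pw (i : nat)%:Z; rewrite /wedge => ->.
    by rewrite -Pg; apply: pair_orbit_refl.
  by rewrite -Pg /= /bump /= add1n -addn1 PoszD; apply: pair_orbit_refl.
exists l => //; rewrite -!Pg /= -[n%:Z]add0r Pn alternate0.
apply/seteqP; split=> x.
  case=> u Uu' <-; exists (scale_pair u (P 0)); first by exists u.
  by rewrite !scale_pairA mulrC.
case=> _ [u Uu' <-] <-; exists u => //.
by rewrite !scale_pairA mulrC.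
Qed.

(** * Injectivity *)

(** After the lift P is multiplied by the alternating powers of u, both lifts have
the same frieze.  Its entries (k, 0) and (k, 1) are the wedges with the
first two pairs, hence the coordinates of the k-th pair. *)
Lemma lifts_sl2_equivalent (U : set R) (g h : 'I_n.+1 -> set (R * R)) P Q u :
    unit_subgroup U -> (0 < n)%N -> U u ->
    extended_lift U g P -> extended_lift U h Q ->
    frieze_of Q = frieze_act u (frieze_of P) :> (band n -> R) ->
  exists2 A, sl2 R A & h = fun k => sl2_pair A @` g k.
Proof.
move=> hU n0 Uu' /(extended_liftP _ n0)[l [_ Pw _ Pg]].
move=> /(extended_liftP _ n0)[l' [_ Qw _ Qh]] QP.
have [Uu _ _ _] := hU; have uu := Uu _ Uu'.
pose P' i := scale_pair (alternate u i) (P i).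
have wE i j : 0 <= i - j -> i - j <= n%:Z ->
    wedge (Q j) (Q i) = wedge (P' j) (P' i).
  move=> ij0 ijn; rewrite -!entry_frieze_of // QP.
  by rewrite (@frieze_of_alternate u P P').
have Q01 : wedge (Q 0) (Q 1) = 1 := Qw 0.
have P01 : wedge (P' 0) (P' 1) = 1 by rewrite -wE //; lia.
have [A hA AE] := sl2_transport P01 Q01.
exists A => //; apply/funext => k; have kn := ltn_ord k.
rewrite -Qh -Pg -(pair_orbit_scale (P (k : nat)%:Z) hU
                    (alternate_in (k : nat)%:Z hU Uu')).
rewrite sl2_pair_orbit; congr pair_orbit.
apply/esym/AE; last by rewrite -wE //; lia.
(* for k = 0 the entry (k, 1) would lie outside the band *)
have [k0|k1] := posnP k; first by rewrite k0 P01 Q01.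
rewrite -/(P' _) wedgeC -wE ?[RHS]wedgeC //; lia.
Qed.

End Friezes.

(** * The correspondence *)

(** Any choice of a representative path and of its lift computes the image of the
orbit; this is the well-definedness of the map. *)
Lemma Psi_path_orbit (R : comPzRingType) (U : set R) (n : nat)
    (g : 'I_n.+1 -> set (R * R)) (P : int -> R * R) :
    unit_subgroup U -> (0 < n)%N -> extended_lift U g P ->
  Psi U n (path_orbit g) = frieze_orbit U (frieze_of P).
Proof.
move=> hU n0 gP; have [Uu _ _ _] := hU.
apply/seteqP; split=> F; last first.
  move=> FP; exists g, P; split=> //; exists 1%:M; first exact: det1.
  apply/funext => i; rewrite -[RHS]image_id.
  by congr (_ @` _); apply/funext => x; rewrite sl2_pair1.
case=> _ [Q [[A hA <-] gQ]].
have [u Uu' QP] := lifts_proportional hU n0 (extended_lift_sl2 n0 hA gP) gQ.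
rewrite (frieze_of_alternate _ (Uu _ Uu') QP) frieze_orbit_act //.
suff -> : frieze_of (fun i => sl2_pair A (P i)) = frieze_of P :> (band n -> R).
  by [].
apply/funext => p; rewrite /frieze_of; case: (val p) => i j.
exact: (wedge_sl2 (P j) (P i) hA).
Qed.

Theorem theorem1p2 (R : comPzRingType) (U : set R) (hU : unit_subgroup U)
    (n : nat) (hn : (2 <= n)%N) :
  set_bij (path_quotient U n) (frieze_quotient U n) (Psi U n).
Proof.
have n0 : (0 < n)%N := ltnW hn.
split.
- move=> _ [g hg <-]; have [P gP] := lift_exists hU n0 hg.
  rewrite (Psi_path_orbit hU n0 gP).
  by exists (frieze_of P) => //; apply: frieze_of_tame gP.
- move=> _ _ /set_mem[g hg <-] /set_mem[h hh <-].
  have [P gP] := lift_exists hU n0 hg; have [Q hQ] := lift_exists hU n0 hh.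
  rewrite (Psi_path_orbit hU n0 gP) (Psi_path_orbit hU n0 hQ) => PQ.
  have : frieze_orbit U (frieze_of Q) (frieze_of (n := n) Q).
    exact: frieze_orbit_refl.
  rewrite -PQ => -[u Uu QP].
  have [A hA ->] := lifts_sl2_equivalent hU n0 Uu gP hQ (esym QP).
  by rewrite path_orbit_sl2.
- move=> _ [F hF <-].
  have [P [Pw PF]] := frieze_chain_exists hF hn.
  have Pz i : wedge (P i) (P (i + n%:Z)) = 0.
    have [[mz _] _ _] := hF; rewrite -(mz i).2 -PF addrC.
    by rewrite entry_frieze_of //; lia.
  have gP := chain_extended_lift U n0 Pw Pz.
  pose g (k : 'I_n.+1) := pair_orbit U (P (k : nat)%:Z).
  exists (path_orbit g).
    by exists g => //; apply: extended_lift_path gP.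
  by rewrite (Psi_path_orbit hU n0 gP) PF.
Qed.
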